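(* There is a polynomial-time algorithm which, given a finite acyclic mixed graph $M=(V,A,E)$ and a vertex $s\in V$, decides whether $M$ has a completion to an acyclic digraph that contains an out-branching rooted at $s$.
   Context: A mixed graph $M=(V,A,E)$ consists of a finite vertex set $V$, a set $A$ of arcs (directed) and a set $E$ of (undirected) edges. Its directed part is the digraph $(V,A)$, and $M$ is acyclic if $(V,A)$ has no directed cycle. A completion of $M$ is a digraph $(V,A\cup A')$, where $A'$ is obtained from $E$ by orienting each edge $uv\in E$ in exactly one of its two directions. A digraph is acyclic if it has no directed cycle. An out-branching rooted at $s$ in a digraph $D=(V,A_D)$ is a spanning subdigraph of $D$ whose underlying graph is a spanning tree and in which every vertex is reachable from $s$ by a directed path; $D$ contains one if and only if every vertex of $D$ is reachable from $s$ by a directed path in $D$. *)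

(* Defs.v *)
From mathcomp Require Import all_boot.

Set Implicit Arguments.
Unset Strict Implicit.
Unset Printing Implicit Defensive.

(* A digraph on V is given by its set of arcs. *)
Section Graphs.
Variable V : finType.

Definition arc_rel (D : {set V * V}) : rel V := [rel u v | (u, v) \in D].

(* Loops and pairs of opposite arcs are directed cycles, of length 1 and 2. *)
Definition acyclic (D : {set V * V}) : Prop :=
  forall c : seq V, ucycle (arc_rel D) c -> c = [::].

Record mixed_graph := MixedGraph {
  arcs : {set V * V};
  edges : {set {set V}};
  card_edge : forall e : {set V}, e \in edges -> #|e| = 2
}.

Definition acyclic_mixed (M : mixed_graph) : Prop := acyclic (arcs M).

Definition is_orientation (E : {set {set V}}) (A' : {set V * V}) : Prop :=
  (forall u v : V, (u, v) \in A' -> [set u; v] \in E) /\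
  (forall u v : V,
     [set u; v] \in E -> ((u, v) \in A') (+) ((v, u) \in A')).

Definition is_completion (M : mixed_graph) (D : {set V * V}) : Prop :=
  exists A' : {set V * V},
    is_orientation (edges M) A' /\ D = arcs M :|: A'.

Definition underlying_rel (B : {set V * V}) : rel V :=
  [rel u v | ((u, v) \in B) || ((v, u) \in B)].

(* A loop or a pair of opposite arcs gives a cycle of length 1 or 2 of the
   underlying multigraph; the third conjunct excludes these, the second one the
   cycles of length at least 3. *)
Definition underlying_spanning_tree (B : {set V * V}) : Prop :=
  [/\ forall u v : V, connect (underlying_rel B) u v,
      forall c : seq V, ucycle (underlying_rel B) c -> size c <= 2
    & forall u v : V, (u, v) \in B -> (v, u) \notin B].

Definition is_out_branching (D : {set V * V}) (s : V) (B : {set V * V}) : Prop :=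
  [/\ B \subset D,
      underlying_spanning_tree B
    & forall v : V, connect (arc_rel B) s v].

(* The number of vertices in unary, the adjacency matrices of the arcs and of
   the edges in row-major order, and the indicator vector of s, all with respect
   to the enumeration of V. *)
Definition encode (M : mixed_graph) (s : V) : seq bool :=
  nseq #|V| true ++ false ::
  [seq (u, v) \in arcs M | u <- enum V, v <- enum V] ++
  [seq [set u; v] \in edges M | u <- enum V, v <- enum V] ++
  [seq v == s | v <- enum V].

End Graphs.

(* Random access machines with registers X_0, X_1, ... holding natural numbers
   and a read-only input bit string. Every instruction has unit cost. The only
   arithmetic is addition and truncated subtraction, so that after t steps every
   register content has at most t bits more than the constants of the program,
   and polynomial time on these machines coincides with polynomial time on Turing
   machines (Cook and Reckhow, 1973). *)
Inductive instr :=
  | Const of nat & nat          (* Const i a   : X_i := a                  *)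
  | Add of nat & nat & nat      (* Add i j k   : X_i := X_j + X_k          *)
  | Sub of nat & nat & nat      (* Sub i j k   : X_i := X_j - X_k          *)
  | Fetch of nat & nat          (* Fetch i j   : X_i := X_(X_j)            *)
  | Store of nat & nat          (* Store i j   : X_(X_i) := X_j            *)
  | Read of nat & nat           (* Read i j    : X_i := input bit no. X_j  *)
  | JumpPos of nat & nat        (* JumpPos j l : if X_j > 0 then goto l    *)
  | Halt of bool.               (* Halt b      : accept or reject          *)

Definition program := seq instr.

Definition memory := nat -> nat.

Definition upd (m : memory) (i a : nat) : memory :=
  fun j => if j == i then a else m j.

(* The configuration (pc, m) either halts with an answer or has a successor.
   Leaving the program rejects; bits beyond the end of the input read as 0. *)
Definition step (P : program) (w : seq bool) (pc : nat) (m : memory) :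
    bool + nat * memory :=
  match nth (Halt false) P pc with
  | Const i a   => inr (pc.+1, upd m i a)
  | Add i j k   => inr (pc.+1, upd m i (m j + m k))
  | Sub i j k   => inr (pc.+1, upd m i (m j - m k))
  | Fetch i j   => inr (pc.+1, upd m i (m (m j)))
  | Store i j   => inr (pc.+1, upd m (m i) (m j))
  | Read i j    => inr (pc.+1, upd m i (nth false w (m j)))
  | JumpPos j l => inr (if 0 < m j then l else pc.+1, m)
  | Halt b      => inl b
  end.

(* Some b if the machine halts with answer b within t steps, None otherwise. *)
Fixpoint run (P : program) (w : seq bool) (t pc : nat) (m : memory) :
    option bool :=
  if t is t'.+1 then
    match step P w pc m with
    | inl b => Some b
    | inr (pc', m') => run P w t' pc' m'
    end
  else None.

Definition decides_within (P : program) (w : seq bool) (t : nat) (Q : Prop) :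
    Prop :=
  exists b : bool, run P w t 0 (fun=> 0) = Some b /\ (b <-> Q).

(* Main.v *)
Require Import Defs.
From mathcomp Require Import all_boot zify.

Set Implicit Arguments.
Unset Strict Implicit.
Unset Printing Implicit Defensive.

(** An acyclic digraph contains an out-branching rooted at [s] as soon as every
    vertex other than [s] has an in-neighbour: a walk backwards from any vertex
    cannot repeat and can only stop at [s]. Hence the desired completion exists
    iff the vertices can be listed so that all arcs go forward and every vertex
    other than [s] has an earlier neighbour, along an arc or an edge; edges are
    then oriented forward. Such a list can be built greedily. A vertex is
    [ready] for the set [S] of vertices listed so far when its arcs all come
    from [S] and it is [s] or has a neighbour in [S]; once ready, it stays ready
    when [S] grows ([ready_sub]), so no choice is ever regretted.

    The set [searched] results from #|V| sweeps over all vertices, in which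
    every vertex found ready is added. A sweep adds a vertex unless the set is
    already stationary, so [searched] is closed ([searched_closed]). If a
    completion exists, a vertex outside [searched] with all its in-neighbours
    inside would be ready, so [searched] is everything ([searched_complete]).
    Conversely, if [searched] is everything, the order in which the vertices
    were added ([searched_rank]) orients the edges and provides the parents of
    an out-branching ([searched_sound]).

    The random access machine performs the sweeps literally: three nested
    loops, each running through #|V| values, with the indicator vector of [S]
    in memory. It is assembled from straight-line blocks by composition and by
    repetition, and verified by Hoare triples that count the steps exactly
    ([triple_block], [triple_seq], [triple_repeat]). The total is a cubic
    polynomial in #|V|, and #|V| is less than the length of the input. *)

(** * The greedy search *)

Section Search.
Variables (V : finType) (M : mixed_graph V) (s : V).
Implicit Types (S T : {set V}) (D : {set V * V}) (l r : seq V).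

Definition adjacent u v := ((u, v) \in arcs M) || ([set u; v] \in edges M).

Definition ready S v :=
  all (fun u => ((u, v) \in arcs M) ==> (u \in S)) (enum V) &&
  ((v == s) || has (fun u => (u \in S) && adjacent u v) (enum V)).

Lemma ready_arc S u v : ready S v -> (u, v) \in arcs M -> u \in S.
Proof. by case/andP=> /allP/(_ u) + _ => /(_ (mem_enum _ _))/implyP. Qed.

Lemma ready_adjacent S v :
  ready S v -> v != s -> exists2 u, u \in S & adjacent u v.
Proof.
case/andP=> _ /orP[->//|/hasP[u _ /andP[Su uv]] _]; by exists u.
Qed.

Definition visit v S := if ready S v then v |: S else S.

(** The list is traversed from its end, as by a loop that counts down. *)
Definition sweep S := foldr visit S (enum V).
Definition searched := iter #|V| sweep set0.

Lemma in_visit S x v :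
  (x \in visit v S) = (x \in S) || ((x == v) && ready S v).
Proof.
by rewrite /visit; case: ifP; rewrite ?inE ?andbT ?andbF ?orbF // orbC.
Qed.

Lemma sub_visit v S : S \subset visit v S.
Proof. by rewrite /visit; case: ifP => // _; apply: subsetUr. Qed.

Lemma sub_visits r S : S \subset foldr visit S r.
Proof. by elim: r => //= v r IH; apply: subset_trans IH (sub_visit _ _). Qed.

Lemma visits_fixed r S v :
  foldr visit S r = S -> v \in r -> ready S v -> v \in S.
Proof.
elim: r => //= x r IH fixS.
have fixr : foldr visit S r = S.
  by apply/eqP; rewrite eqEsubset sub_visits andbT -{2}fixS sub_visit.
rewrite inE => /orP[/eqP-> rx|]; last exact: IH.
by rewrite -fixS fixr /visit rx setU11.
Qed.

(** As long as the sweeps are not stationary each of them adds a vertex; a set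
    of #|V| vertices is stationary for want of further vertices. *)
Lemma searched_closed v : ready searched v -> v \in searched.
Proof.
suff fixS : sweep searched = searched.
  by apply: (visits_fixed fixS); rewrite mem_enum.
have grow k : let S := iter k sweep set0 in k <= #|S| \/ sweep S = S.
  elim: k => [|k /= IH]; first by left.
  set S := iter k sweep set0 in IH *.
  have [fixS|neqS] := eqVneq (sweep S) S; first by right; rewrite !fixS.
  case: IH => [leS|fixS]; last by rewrite fixS eqxx in neqS.
  left; apply: leq_ltn_trans leS _; apply: proper_card.
  by rewrite properEneq eq_sym neqS sub_visits.
have [big|//] := grow #|V|.
have full : searched = [set: V] by apply/eqP; rewrite eqEcard subsetT cardsT.
by apply/eqP; rewrite eqEsubset sub_visits full subsetT.
Qed.

(** A vertex [v] of [T] with the fewest ancestors works: an in-neighbour of [v]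
    in [T] would have the same ancestors, [v] among them, and close a cycle. *)
Lemma acyclic_source D T x :
  acyclic D -> x \in T ->
  exists2 v, v \in T & forall u, (u, v) \in D -> u \notin T.
Proof.
move=> acD Tx; pose below v := [set u | connect (arc_rel D) u v].
case: (arg_minnP (fun v => #|below v|) Tx) => v Tv min_v.
exists v => // u Duv; apply/negP => Tu.
have sub : below u \subset below v.
  apply/subsetP => z; rewrite !inE => zu.
  exact: connect_trans zu (connect1 Duv).
have /eqP eq_uv : below u == below v by rewrite eqEcard sub min_v.
have : v \in below u by rewrite eq_uv inE connect0.
rewrite inE => /connectP[p0 /shortenP[p vp uniq_p _] u_last].
suff /acD : ucycle (arc_rel D) (v :: p) by [].
by rewrite /ucycle uniq_p andbT /= rcons_path vp /= -u_last.
Qed.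

(** Among the vertices outside [searched], take one without in-neighbours
    outside. The last arc of a path from [s] to it shows that it is ready, which
    contradicts that [searched] is closed. *)
Lemma searched_complete D B :
  is_completion M D -> acyclic D -> is_out_branching D s B ->
  searched = [set: V].
Proof.
move=> [A' [[A'E _] ->]] acD [/subsetP BD _ reach].
apply/eqP; rewrite -subTset; apply/subsetP => x _.
rewrite -[_ \in _]negbK -in_setC; apply/negP => /(acyclic_source acD)[v].
rewrite inE => /negP nSv preds; apply: nSv; apply: searched_closed.
have pred_in u : (u, v) \in arcs M :|: A' -> u \in searched.
  by move/preds; rewrite inE negbK.
apply/andP; split.
  by apply/allP => u _; apply/implyP => uv; apply: pred_in; rewrite inE uv.
case: (eqVneq v s) => //= neq_vs.
case/connectP: (reach v) => p; case/lastP: p => [|p y] /=.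
  by move=> _ eq_vs; rewrite eq_vs eqxx in neq_vs.
rewrite rcons_path last_rcons => /andP[_ /= /BD Duv] eq_vy.
rewrite -{y}eq_vy in Duv.
apply/hasP; exists (last s p); first by rewrite mem_enum.
rewrite pred_in //=; move: Duv; rewrite inE /adjacent => /orP[->//|/A'E->].
by rewrite orbT.
Qed.

Lemma ready_sub S T v : S \subset T -> ready S v -> ready T v.
Proof.
move=> /subsetP sST /andP[/allP inS adjS]; apply/andP; split.
  by apply/allP => u /inS /implyP uS; apply/implyP => /uS /sST.
case/orP: adjS => [->//|/hasP[u _ /andP[Su uv]]].
by apply/orP; right; apply/hasP; exists u; rewrite ?mem_enum // sST.
Qed.

(** The condition that [f] is below #|S| on [S] leaves #|S| as the rank of the
    next vertex. *)
Definition search_rank (f : V -> nat) S :=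
  [/\ {in S &, injective f}, forall v, v \in S -> f v < #|S|
    & forall v, v \in S -> ready [set u in S | f u < f v] v].

Lemma visit_rank S v :
  (exists f, search_rank f S) -> exists f, search_rank f (visit v S).
Proof.
move=> [f rankS]; rewrite /visit; case: ifP => [rdy|_]; last by exists f.
have [Sv|nSv] := boolP (v \in S).
  by exists f; rewrite (setUidPr _) // sub1set.
have [injf ltf rdyf] := rankS.
pose g x := if x == v then #|S| else f x; exists g.
have gv : g v = #|S| by rewrite /g eqxx.
have gS x : x \in S -> g x = f x.
  by rewrite /g; case: eqP => // -> Sv; rewrite Sv in nSv.
have below : S \subset [set u in v |: S | g u < g v].
  by apply/subsetP => u Su; rewrite !inE Su orbT gv gS //= ltf.
split=> [x y|x|x]; rewrite ?cardsU1 ?nSv ?inE.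
- case/predU1P=> [->|Sx] /predU1P[->|Sy] //; rewrite ?gv ?gS //.
  - by move=> eq_f; have := ltf _ Sy; rewrite -eq_f ltnn.
  - by move=> eq_f; have := ltf _ Sx; rewrite eq_f ltnn.
  - exact: injf.
- case/predU1P=> [->|Sx]; first by rewrite gv.
  by rewrite gS // ltnS ltnW // ltf.
- case/predU1P=> [->|Sx]; first exact: ready_sub below rdy.
  apply: ready_sub (rdyf x Sx); apply/subsetP => u.
  rewrite !inE => /andP[Su lt_ux].
  by rewrite Su orbT !gS.
Qed.

Lemma searched_rank : exists f, search_rank f searched.
Proof.
rewrite /searched; elim: #|V| => [|k].
  by exists (fun=> 0); split=> ?; rewrite inE.
rewrite iterS /sweep; move: (iter k _ _) => S.
by elim: (enum V) => //= v r IH /IH; apply: visit_rank.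
Qed.

Lemma rank_acyclic (f : V -> nat) D :
  (forall u v, (u, v) \in D -> f u < f v) -> acyclic D.
Proof.
move=> incr [//|x p] /andP[cyc _].
have : path ltn (f x) (map f (rcons p x)).
  by rewrite path_map; apply: sub_path cyc => u v; apply: incr.
move/(order_path_min ltn_trans)/allP/(_ (f x)).
by rewrite map_rcons mem_rcons mem_head ltnn => /(_ isT).
Qed.

(** The arcs from [p v] to [v] go up in [f]. A path of arcs from [s] to [v]
    exists by induction on [f v]. On a cycle of the underlying graph, both
    neighbours of a vertex with maximal [f] are its parent, so they coincide. *)
Lemma parent_branching (f : V -> nat) (p : V -> V) (B : {set V * V}) :
    (forall v, v != s -> f (p v) < f v) ->
    (forall u v, ((u, v) \in B) = (v != s) && (u == p v)) ->
  is_out_branching B s B.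
Proof.
move=> lt_p inB.
have incr u v : (u, v) \in B -> f u < f v.
  by rewrite inB => /andP[/lt_p lt /eqP->].
have reach v : connect (arc_rel B) s v.
  have [k] := ubnP (f v); elim: k => // k IH in v * => /ltnSE le_v.
  have [->//|ns] := eqVneq v s.
  apply: connect_trans (IH (p v) (leq_trans (lt_p _ ns) le_v)) (connect1 _).
  by rewrite /arc_rel /= inB ns eqxx.
split=> //; split=> [u v|c|u v /incr lt_uv]; last first.
- by apply/negP => /incr; rewrite ltnNge ltnW.
  (* The cycle is rotated so that it starts at a vertex with maximal [f]. *)
- have [//|long] := leqP (size c) 2; case/andP=> cyc uniq_c.
  have [x0 c0] : exists x, x \in c.
    by case: c long {cyc uniq_c} => // x c; exists x; rewrite mem_head.
  case: (arg_maxnP f c0) => x cx max_x.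
  have [i q def_q] := rot_to cx.
  move: long cyc uniq_c.
  rewrite -(size_rot i) -(rot_cycle i) -(rot_uniq i) def_q.
  have up y :
      y \in q -> underlying_rel B x y || underlying_rel B y x -> y = p x.
    move=> qy; have le_y : f y <= f x.
      suff /max_x : y \in c by [].
      by rewrite -(mem_rot i) def_q inE qy orbT.
    suff no : (x, y) \notin B.
      by rewrite /underlying_rel /= !(negPf no) orbF orbb inB => /andP[_ /eqP].
    by apply/negP => /incr; rewrite ltnNge le_y.
  case: q {def_q} up => //= y q up; case/lastP: q up => //= q z up _.
  rewrite !rcons_path last_rcons => /and3P[xy _ zx] /and3P[_ + _].
  rewrite (up y) ?mem_head ?xy // (up z) ?zx ?orbT //; last first.
    by rewrite inE mem_rcons mem_head orbT.
  by rewrite mem_rcons mem_head.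
- have sub a b : connect (arc_rel B) a b -> connect (underlying_rel B) a b.
    apply: connect_sub => {}a {}b ab; apply: connect1.
    by rewrite /underlying_rel /= [_ \in B]ab.
  apply: connect_trans (sub _ _ (reach v)).
  rewrite (@sym_connect_sym _ (underlying_rel B)) ?sub // => a b.
  by rewrite /underlying_rel /= orbC.
Qed.

Lemma searched_sound :
  searched = [set: V] ->
  exists D,
    [/\ is_completion M D, acyclic D & exists B, is_out_branching D s B].
Proof.
have [f [+ _]] := searched_rank => + + full; rewrite full => injf rdyf.
have rdy v : ready [set u | f u < f v] v.
  by apply: ready_sub (rdyf v (in_setT v)); apply/subsetP=> u; rewrite !inE.
pose A' := [set e : V * V | ([set e.1; e.2] \in edges M) && (f e.1 < f e.2)].
exists (arcs M :|: A').
have incr u v : (u, v) \in arcs M :|: A' -> f u < f v.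
  by rewrite !inE => /orP[/(ready_arc (rdy v))|/andP[]//]; rewrite inE.
split; [| exact: rank_acyclic incr |].
- exists A'; split=> //; split=> u v; rewrite !inE /=; first by case/andP.
  move=> uv; rewrite (setUC [set v]) uv /=.
  have: u != v.
    apply: contraTneq uv => ->; apply/negP => /card_edge.
    by rewrite setUid cards1.
  by case: ltngtP => // /injf-> //; rewrite eqxx.
pose p v := odflt s [pick u | (f u < f v) && adjacent u v].
have p_ok v : v != s -> (f (p v) < f v) && adjacent (p v) v.
  move=> ns; rewrite /p; case: pickP => //= none.
  have [u] := ready_adjacent (rdy v) ns; rewrite inE => lt uv.
  by have := none u; rewrite lt uv.
pose B := [set e : V * V | (e.2 != s) && (e.1 == p e.2)].
exists B; have [_ tree reach] : is_out_branching B s B.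
  apply: (@parent_branching f p) => [v /p_ok/andP[]//|u v]; by rewrite inE.
split=> //; apply/subsetP => -[u v]; rewrite !inE /= => /andP[/p_ok + /eqP->].
by case/andP=> -> /orP[->//|->]; rewrite orbT.
Qed.

End Search.

(** * Fragments of programs and timed Hoare triples *)

Local Notation Sub := Defs.Sub.

(** Jumps have absolute targets, so code depends on its first address. *)
Definition fragment := nat -> program.

Definition assertion := memory -> Prop.

Definition occurs (F : fragment) l (P : program) :=
  forall i, i < size (F l) ->
    nth (Halt false) P (l + i) = nth (Halt false) (F l) i.

(** Control passes from the first address of [F] to the address just behind [F]
    in exactly [t] steps. *)
Definition triple w (pre : assertion) (F : fragment) t (post : assertion) :=
  forall P l m, occurs F l P -> pre m -> exists2 m', post m' &
    forall T, run P w (t + T) l m = run P w T (l + size (F l)) m'.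

Definition straight (i : instr) :=
  match i with JumpPos _ _ | Halt _ => false | _ => true end.

(** The memory is computed address by address, so that the contents of one
    register after a block simplify without unfolding the other registers. *)
Definition effect w (m : memory) (i : instr) (x : nat) : nat :=
  match i with
  | Const j a => if x == j then a else m x
  | Add j k l => if x == j then m k + m l else m x
  | Sub j k l => if x == j then m k - m l else m x
  | Fetch j k => if x == j then m (m k) else m x
  | Store j k => if x == m j then m k else m x
  | Read j k => if x == j then nth false w (m k) : nat else m x
  | _ => m x
  end.

Definition block (code : program) : fragment := fun=> code.
Definition seqf (F G : fragment) : fragment := fun l =>
  F l ++ G (l + size (F l)).

(** The test comes after the body, which therefore runs at least once; there is
    no unconditional jump. *)
Definition repeat (F : fragment) r : fragment := fun l =>
  rcons (F l) (JumpPos r l).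

Lemma triple_conseq w (pre' pre : assertion) F t post (post' : assertion) :
    (forall m, pre' m -> pre m) -> (forall m, post m -> post' m) ->
  triple w pre F t post -> triple w pre' F t post'.
Proof.
move=> sub_pre sub_post tr P l m PF /sub_pre /(tr _ _ _ PF).
case=> m' /sub_post pm' run_m.
by exists m'.
Qed.

Lemma triple_block w (pre : assertion) code (post : assertion) :
    all straight code ->
    (forall m, pre m -> post (foldl (effect w) m code)) ->
  triple w pre (block code) (size code) post.
Proof.
move=> str pre_post P l m PF /pre_post post_m.
exists (foldl (effect w) m code) => // T; rewrite /block {pre_post post_m}.
elim: code str l m PF => /= [|i code IH]; first by move=> *; rewrite addn0.
case/andP=> str_i str l m PF; rewrite addnS -addSn -IH //; last first.
  by move=> j lt_j; rewrite addSnnS PF.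
have := PF 0 isT; rewrite addn0 /step => /= ->.
by case: i str_i {PF}.
Qed.

Lemma triple_seq w pre F t mid G u post :
  triple w pre F t mid -> triple w mid G u post ->
  triple w pre (seqf F G) (t + u) post.
Proof.
move=> trF trG P l m PFG pre_m.
have [|m1 mid_m1 run1] := trF P l m _ pre_m.
  by move=> i lt_i; rewrite PFG /seqf ?size_cat ?nth_cat ?lt_i // ltn_addr.
have [|m2 post_m2 run2] := trG P (l + size (F l)) m1 _ mid_m1.
  move=> i lt_i; rewrite -addnA PFG /seqf ?size_cat ?ltn_add2l //.
  by rewrite nth_cat ltnNge leq_addr addKn.
by exists m2 => // T; rewrite -addnA run1 run2 /seqf size_cat addnA.
Qed.

Lemma run_jump P w l r l' T m :
  nth (Halt false) P l = JumpPos r l' ->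
  run P w T.+1 l m = run P w T (if 0 < m r then l' else l.+1) m.
Proof. by rewrite /= /step => ->. Qed.

(** The index of the invariant is the number of iterations left. *)
Lemma triple_repeat w (inv : nat -> assertion) F t r n :
    0 < n ->
    (forall k, triple w (inv k.+1) F t
                 (fun m => inv k m /\ (0 < m r) = (0 < k))) ->
  triple w (inv n) (repeat F r) (n * t.+1) (inv 0).
Proof.
case: n => // n _ body P l m PF.
have PF' : occurs F l P.
  by move=> i lt_i; rewrite PF /repeat ?size_rcons ?nth_rcons ?lt_i // ltnW.
have jump : nth (Halt false) P (l + size (F l)) = JumpPos r l.
  by rewrite PF /repeat ?size_rcons ?nth_rcons ?ltnn ?eqxx.
elim: n m => [|n IH] m /(body _ _ _ _ PF')[m1 [inv_m1 test] run1].
  exists m1 => // T; rewrite mul1n addSnnS run1 (run_jump _ _ _ jump) test.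
  by rewrite /repeat size_rcons addnS.
have [m2 inv_m2 run2] := IH _ inv_m1.
exists m2 => // T; rewrite mulSn -addnA addSnnS run1 (run_jump _ _ _ jump) test.
by rewrite run2.
Qed.

Lemma run_more P w t u l m b :
  t <= u -> run P w t l m = Some b -> run P w u l m = Some b.
Proof.
elim: t u l m => // t IH [//|u] l m le_tu /=.
by case: (step P w l m) => // -[l' m']; apply: IH.
Qed.

(** * The program *)

(** [XNN] holds the square of [XN]; [XRound], [XV] and [XU] are the counters of
    the loops over sweeps, visited vertices and their neighbours; [XPtr] is the
    position of the input bit for the arc from [XU] to [XV]; [XCnt] is #|S|. The
    indicator vector of [S] starts at address [base]. [XZero] is never written,
    and [XA], [XB], [XC] are scratch. *)
Local Notation XN := 0 (only parsing).
Local Notation XOne := 1 (only parsing).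
Local Notation XBase := 2 (only parsing).
Local Notation XNN := 3 (only parsing).
Local Notation XRound := 4 (only parsing).
Local Notation XV := 5 (only parsing).
Local Notation XU := 6 (only parsing).
Local Notation XPtr := 7 (only parsing).
Local Notation XBad := 8 (only parsing).
Local Notation XGood := 9 (only parsing).
Local Notation XA := 10 (only parsing).
Local Notation XB := 11 (only parsing).
Local Notation XC := 12 (only parsing).
Local Notation XZero := 13 (only parsing).
Local Notation XCnt := 14 (only parsing).
Local Notation base := 15.

(** Let [p], [a] and [e] be the bits for [XU] in [S], for its arc to [XV] and
    for its edge to [XV]. Subtraction being truncated, [XBad] grows by [a - p],
    which is 1 iff the arc comes from outside [S], and [XGood] grows by
    [(a + e) - 2 * (1 - p)], which is positive iff [XU] is a neighbour of [XV]
    in [S]. *)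
Definition inspect_neighbour := block
  [:: Sub XU XU XOne;
      Sub XPtr XPtr XN;
      Add XA XBase XU;
      Fetch XA XA;
      Read XB XPtr;
      Sub XC XB XA;
      Add XBad XBad XC;
      Add XC XPtr XNN;
      Read XC XC;
      Add XB XB XC;
      Sub XA XOne XA;
      Add XA XA XA;
      Sub XB XB XA;
      Add XGood XGood XB].

(** [XPtr] starts one row behind the adjacency matrix of the arcs, since
    [inspect_neighbour] moves it back before reading; [XGood] starts with the
    bit that identifies the root. *)
Definition start_visit := block
  [:: Sub XV XV XOne;
      Add XPtr XN XOne;
      Add XPtr XPtr XNN;
      Add XPtr XPtr XV;
      Add XA XPtr XNN;
      Read XGood XA;
      Const XBad 0;
      Add XU XN XZero].

(** [XBad] becomes 1 if [XV] is ready and not yet in [S], and 0 otherwise. *)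
Definition finish_visit := block
  [:: Sub XBad XOne XBad;
      Sub XGood XOne XGood;
      Sub XBad XBad XGood;
      Add XC XBase XV;
      Fetch XA XC;
      Sub XBad XBad XA;
      Add XA XA XBad;
      Store XC XA;
      Add XCnt XCnt XBad].

Definition visit_code :=
  seqf start_visit (seqf (repeat inspect_neighbour XU) finish_visit).

Definition sweep_code :=
  seqf (block [:: Sub XRound XRound XOne; Add XV XN XZero])
       (repeat visit_code XV).

(** The zero bit behind the unary part of the input stops the loop. *)
Definition count_code :=
  seqf (block [:: Const XOne 1])
       (repeat (block [:: Read XA XN; Add XN XN XA]) XA).

Definition square_code :=
  seqf (block [:: Add XU XN XZero])
       (repeat (block [:: Sub XU XU XOne; Add XNN XNN XN]) XU).

Definition search_code :=
  seqf count_code (seqf square_code (seqf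
    (block [:: Const XBase base; Add XRound XN XZero])
    (repeat sweep_code XRound))).

(** The answer is positive iff [XN - XCnt] is 0, that is, iff [S] contains all
    vertices. *)
Definition search_program : program :=
  let P := search_code 0 in
  P ++ [:: Sub XN XN XCnt; JumpPos XN (size P + 3); Halt true; Halt false].

(** * Positions in the input *)

Lemma nth_allpairs_row (T R : Type) (x0 : T) (y0 : R) (f : T -> T -> R)
    (r t : seq T) i j q :
  i < size r -> j < size t ->
  nth y0 ([seq f x y | x <- r, y <- t] ++ q) (i * size t + j) =
    f (nth x0 r i) (nth x0 t j).
Proof.
move=> lt_i lt_j; elim: r i lt_i => //= x r IH [|i] lt_i.
  by rewrite -catA nth_cat size_map lt_j (nth_map x0).
by rewrite -catA nth_cat size_map mulSn -addnA ltnNge leq_addr addKn IH.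
Qed.

(** * Correctness and running time of the program *)

(** The indicator vector and the registers below it do not overlap. *)
Lemma far c i r : r < c -> (c + i == r) = false.
Proof. by move=> lt; rewrite gtn_eqF // ltn_addr. Qed.

Section Program.
Variables (V : finType) (M : mixed_graph V) (s : V).

Local Notation n := #|V|.
Local Notation w := (encode M s).
Let vtx := nth s (enum V).
Implicit Types (S : {set V}) (m : memory).
Let n_gt0 : 0 < n. Proof. by apply/card_gt0P; exists s. Qed.
Let size_enum : size (enum V) = n. Proof. by rewrite cardE. Qed.

Lemma input_length i : i <= n -> nth false w i = (i < n).
Proof.
rewrite leq_eqVlt /encode nth_cat size_nseq => /predU1P[->|lt_i].
  by rewrite ltnn subnn.
by rewrite lt_i nth_nseq lt_i.
Qed.

Lemma input_arc i j :
  i < n -> j < n ->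
  nth false w (i * n + j + n + 1) = ((vtx i, vtx j) \in arcs M).
Proof.
move=> lt_i lt_j; rewrite /encode nth_cat size_nseq addn1 -addnS.
rewrite ltnNge (leq_trans (leqnSn n) (leq_addl _ _)) /=.
rewrite addnS subSn ?leq_addl //.
by rewrite addnK /= -size_enum (nth_allpairs_row s) ?size_enum.
Qed.

Lemma input_edge i j :
  i < n -> j < n ->
  nth false w (i * n + j + n + 1 + n * n) = ([set vtx i; vtx j] \in edges M).
Proof.
move=> lt_i lt_j; rewrite /encode nth_cat size_nseq addn1.
rewrite addSnnS -addnA addnCA ltnNge leq_addr addKn addnS /=.
rewrite nth_cat size_allpairs size_enum ltnNge leq_addl addnK /=.
by rewrite -size_enum (nth_allpairs_row s) ?size_enum.
Qed.

Lemma input_root j :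
  j < n -> nth false w (j + n + 1 + n * n + n * n) = (vtx j == s).
Proof.
move=> lt_j; have -> : j + n + 1 + n * n + n * n = n + (j + n * n + n * n).+1.
  by rewrite addn1 !addSn addnS !addnA (addnC n j).
rewrite /encode nth_cat size_nseq ltnNge leq_addr addKn /=.
rewrite nth_cat size_allpairs size_enum ltnNge leq_addl addnK.
rewrite nth_cat size_allpairs size_enum ltnNge leq_addl addnK.
by rewrite (nth_map s) ?size_enum.
Qed.

Lemma leq_size_encode : n < size w.
Proof. by rewrite /encode size_cat size_nseq /= addnS ltnS leq_addr. Qed.

(** The registers from [XZero] on, and the indicator vector behind them, are
    still blank: the empty set is represented before the first sweep. *)
Lemma triple_count :
  triple w (fun m => forall x, m x = 0) count_code (1 + n.+1 * 3)
    (fun m => [/\ m XN = n, m XOne = 1, m XNN = 0 & forall i, m (13 + i) = 0]).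
Proof.
pose inv k m := [/\ k <= n.+1, m XN = minn n (n.+1 - k), m XOne = 1, m XNN = 0
                  & forall i, m (13 + i) = 0].
apply: (@triple_seq _ _ _ _ (inv n.+1)).
  apply: triple_block => // m m0.
  by split=> //= *; rewrite ?far // ?m0 // subnn minn0.
apply: (@triple_conseq _ (inv n.+1) (inv n.+1) _ _ (inv 0)) => //.
  by move=> m [_ -> -> -> m0]; rewrite subn0 (minn_idPl (leqnSn _)).
apply: triple_repeat => // k; apply: triple_block => // m.
case=> lt_k mN m1 mNN m0.
have {}mN : m XN = n - k by rewrite mN subSS (minn_idPr (leq_subr _ _)).
have bit : nth false w (n - k) = (0 < k).
  by rewrite input_length ?leq_subr // ltn_subrL n_gt0 andbT.
split; last by rewrite /= mN bit; case: (k).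
split=> /=; rewrite ?mN ?bit ?far //; first exact: ltnW.
  case: k lt_k {mN bit} => [|k] lt_k.
    by rewrite !subn0 addn0 (minn_idPl _).
  by rewrite addn1 subSS subnSK // (minn_idPr (leq_subr _ _)).
Qed.

Lemma triple_square :
  triple w (fun m => [/\ m XN = n, m XOne = 1, m XNN = 0
                    & forall i, m (13 + i) = 0])
    square_code (1 + n * 3)
    (fun m => [/\ m XN = n, m XOne = 1, m XNN = n * n
                & forall i, m (13 + i) = 0]).
Proof.
pose inv k m :=
  [/\ k <= n, m XN = n, m XOne = 1, m XU = k & m XNN = (n - k) * n]
  /\ forall i, m (13 + i) = 0.
apply: (@triple_seq _ _ _ _ (inv n)).
  apply: triple_block => // m [mN m1 mNN m0].
  split=> //.
  by split=> //=; rewrite ?mN ?subnn ?mNN // -[m 13]/(m (13 + 0)) m0 addn0.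
apply: (@triple_conseq _ (inv n) (inv n) _ _ (inv 0)) => //.
  by move=> m [[_ -> -> _ ->] m0]; rewrite subn0.
apply: triple_repeat => // k; apply: triple_block => // m.
move=> [[lt_k mN m1 mU mNN] m0]; split; last by rewrite /= mU m1 subn1.
split=> //.
split=> //=; rewrite ?mU ?m1 ?mNN ?subn1 ?mN //; first exact: ltnW.
by rewrite addnC -mulSn subnSK.
Qed.

Definition holds S m :=
  [/\ m XN = n, m XOne = 1, m XBase = base, m XNN = n * n & m XZero = 0]
  /\ (m XCnt = #|S| /\ forall i, i < n -> m (base + i) = (vtx i \in S)).

(** [k] neighbours of the vertex number [v] are still to be inspected. *)
Definition inspecting S j v k m :=
  [/\ holds S m, [/\ v < n, m XRound = j & m XV = v],
      [/\ k <= n, m XU = k & m XPtr = k * n + v + n + 1],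
      (m XBad == 0) = all (fun u => ((u, vtx v) \in arcs M) ==> (u \in S))
                          (drop k (enum V))
    & (0 < m XGood) = (vtx v == s) ||
        has (fun u => (u \in S) && adjacent M u (vtx v)) (drop k (enum V))].

Lemma triple_inspect S j v k :
  triple w (inspecting S j v k.+1) inspect_neighbour 14
    (fun m => inspecting S j v k m /\ (0 < m XU) = (0 < k)).
Proof.
apply: triple_block => // m.
case=> [[[mN m1 mB mNN mZ] [mC mS]] [lt_v mR mV] [lt_k mU mP] bad good].
have Uk : m XU - m XOne = k by rewrite mU m1 subn1.
have P1 : m XPtr - m XN = k * n + v + n + 1.
  by rewrite mP mN mulSn -!addnA addKn !addnA.
split; last by rewrite /= Uk.
split=> //.
- by split=> //=; rewrite ?Uk ?P1 ?(ltnW lt_k).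
- rewrite (drop_nth s) ?size_enum //= -bad Uk P1 mB mS // input_arc //.
  by case: (_ \in arcs M); case: (_ \in S); rewrite /= ?addn0 ?addn1 ?andbF.
rewrite (drop_nth s) ?size_enum //= orbCA -good Uk P1 mB mS // m1 mNN.
rewrite input_arc // input_edge // /adjacent.
by case: (_ \in arcs M); case: (_ \in edges M); case: (_ \in S); rewrite addnC.
Qed.

(** The current sweep started with [S] and has [k] more vertices to visit. *)
Definition sweeping S j k m :=
  [/\ holds (foldr (visit M s) S (drop k (enum V))) m, k <= n,
      m XRound = j & m XV = k].

Lemma triple_start S j k :
  triple w (sweeping S j k.+1) start_visit 8
    (inspecting (foldr (visit M s) S (drop k.+1 (enum V))) j k n).
Proof.
apply: triple_block => // m [[[mN m1 mB mNN mZ] [mC mS]] lt_k mR mV].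
have Vk : m XV - m XOne = k by rewrite mV m1 subn1.
have ptr : m XN + m XOne + m XNN + (m XV - m XOne) = n * n + k + n + 1.
  by rewrite Vk mN m1 mNN -addnA addnC addnA.
have root : n * n + k + n + 1 + n * n = k + n + 1 + n * n + n * n.
  by rewrite -!(addnA (n * n)) addnC.
rewrite /inspecting [drop n _]drop_oversize ?size_enum //=; split=> //.
- by rewrite ptr mN mZ addn0.
by rewrite ptr mNN root input_root // lt0b orbF.
Qed.

Lemma triple_finish S j v :
  triple w (inspecting S j v 0) finish_visit 9
    (fun m => [/\ holds (visit M s (vtx v) S) m, v < n,
                  m XRound = j & m XV = v]).
Proof.
apply: triple_block => // m.
case=> [[[mN m1 mB mNN mZ] [mC mS]] [lt_v mR mV] _ bad good].
(* With truncated subtraction, [1 - x] is the bit for x = 0. *)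
have ok : 1 - m XBad - (1 - m XGood) = ready M s S (vtx v).
  rewrite /ready -[in RHS](drop0 (enum V)) -bad -good.
  by case: (m XBad) (m XGood) => [|?] [|?].
have new : 1 - m XBad - (1 - m XGood) - m (base + v) =
           ready M s S (vtx v) && (vtx v \notin S).
  by rewrite ok mS //; case: (ready _ _ _ _); case: (_ \in S).
have nreg r : r < base -> (r == base + v) = false.
  by move=> lt; rewrite eq_sym far.
split=> //; try by rewrite /= mB mV !nreg.
split=> //; split; rewrite /= m1 mB mV new ?nreg //.
  rewrite mC /visit; case: (ready _ _ _ _) => /=; last by rewrite addn0.
  by rewrite cardsU1 addnC.
move=> i lt_i; rewrite eqn_add2l !mS //.
have -> : (i == v) = (vtx i == vtx v) by rewrite nth_uniq ?enum_uniq ?size_enum.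
rewrite in_visit; case: eqP => [->|_]; last by rewrite orbF.
by case: (ready _ _ _ _); case: (_ \in S).
Qed.

Lemma triple_visit S j k :
  triple w (sweeping S j k.+1) visit_code (8 + (n * 15 + 9))
    (fun m => sweeping S j k m /\ (0 < m XV) = (0 < k)).
Proof.
apply: triple_seq (@triple_start S j k) _.
set S' := foldr _ _ _; apply: (@triple_seq _ _ _ _ (inspecting S' j k 0)).
  by apply: (triple_repeat n_gt0) => i; apply: triple_inspect.
apply: triple_conseq (@triple_finish S' j k) => [//|m [holds_m lt_k mR mV]].
split; last by rewrite mV.
by split=> //; [rewrite (drop_nth s) ?size_enum | apply: ltnW].
Qed.

(** [i] sweeps are still to be made. *)
Definition swept i m :=
  holds (iter (n - i) (sweep M s) set0) m /\ (i <= n /\ m XRound = i).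

Lemma triple_sweep k :
  triple w (swept k.+1) sweep_code (2 + n * (8 + (n * 15 + 9)).+1)
    (fun m => swept k m /\ (0 < m XRound) = (0 < k)).
Proof.
set S := iter (n - k.+1) (sweep M s) set0.
apply: (@triple_seq _ _ _ _ (fun m => k < n /\ sweeping S k n m)).
  apply: triple_block => // m [[[mN m1 mB mNN mZ] [mC mS]] [lt_k mR]].
  split=> //; split=> //=; last 2 first.
  - by rewrite mR m1 subn1.
  - by rewrite mN mZ addn0.
  by rewrite drop_oversize ?size_enum //.
have [lt_k|ge_k] := ltnP k n; last by move=> P l m _ [].
apply: (@triple_conseq _ _ (sweeping S k n) _ _ (sweeping S k 0)).
- by move=> m [].
- move=> m.
  rewrite /sweeping drop0 => -[holds_m _ mR mV].
  split; last by rewrite mR.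
  by split; [rewrite -subnSK | rewrite ltnW].
by apply: (triple_repeat n_gt0) => i; apply: triple_visit.
Qed.

(** Counting, squaring, and the three nested loops. *)
Definition search_time :=
  1 + n.+1 * 3 + (1 + n * 3 + (2 + n * (2 + n * (8 + (n * 15 + 9)).+1).+1)).

Lemma triple_search :
  triple w (fun m => forall x, m x = 0) search_code search_time
    (holds (searched M s)).
Proof.
apply: triple_seq triple_count _; apply: triple_seq triple_square _.
apply: (@triple_seq _ _ _ _ (swept n)).
  apply: triple_block => // m [mN m1 mNN m0].
  rewrite /swept subnn; split; last first.
    by rewrite /= mN -[m 13]/(m (13 + 0)) m0 addn0.
  split; first by split=> //=; apply: (m0 0).
  split; first by rewrite cards0; apply: (m0 1).
  by move=> i _; rewrite inE; apply: (m0 i.+2).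
apply: (@triple_conseq _ (swept n) (swept n) _ _ (swept 0)) => //.
  by move=> m [+ _]; rewrite subn0.
by apply: (triple_repeat n_gt0) => i; apply: triple_sweep.
Qed.

Lemma run_search :
  run search_program w (search_time + 3) 0 (fun=> 0) =
    Some (searched M s == [set: V]).
Proof.
have occ : occurs search_code 0 search_program.
  by move=> i lt_i; rewrite /search_program nth_cat lt_i.
have [m [[mN _ _ _ _] [mC _]] ->] :=
  @triple_search _ 0 (fun=> 0) occ (fun=> erefl).
have -> : (searched M s == [set: V]) = (n - #|searched M s| == 0).
  by rewrite subn_eq0 eqEcard subsetT cardsT.
rewrite -mN -mC.
by case E: (m XN - m XCnt) => [|d]; rewrite /= E.
Qed.

Lemma search_time_polynomial : search_time + 3 <= 50 * size w ^ 3 + 50.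
Proof.
have: n.+1 ^ 3 <= size w ^ 3 by rewrite leq_exp2r // leq_size_encode.
rewrite -(leq_pmul2l (isT : 0 < 50)) -(leq_add2r 50); apply: leq_trans.
rewrite /search_time; move: (n) => x.
rewrite !expnS expn0 muln1.
nia.
Qed.

End Program.

Theorem mainTheorem1 :
  exists (P : program) (c k : nat),
    forall (V : finType) (M : mixed_graph V) (s : V),
      acyclic_mixed M ->
      decides_within P (encode M s) (c * size (encode M s) ^ k + c)
        (exists D : {set V * V},
           [/\ is_completion M D,
               acyclic D
             & exists B : {set V * V}, is_out_branching D s B]).
Proof.
exists search_program, 50, 3 => V M s _.
exists (searched M s == [set: V]); split.
  exact: run_more (search_time_polynomial M s) (run_search M s).
split=> [/eqP/searched_sound//|[D [compD acD [B branchB]]]].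
exact/eqP/(searched_complete compD acD branchB).
Qed.
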